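(* Let $r,n\ge1$ and let $\mathbf f=(f_1,\dots,f_n)$ be integers with $1\le f_1\le f_2\le\cdots\le f_n\le n$. Over $\mathsf{G}_{r,n,\mathbf f}$, the tuple of (set-valued) statistics $$\bigl(\ell,\mathsf{Rmil}^0,\mathsf{Rmil}^1,\dots,\mathsf{Rmil}^{r-1},\mathsf{Lmil}^0,\dots,\mathsf{Lmil}^{r-1},\mathsf{Lmal}^0,\dots,\mathsf{Lmal}^{r-1},\mathsf{Lmap}^0,\dots,\mathsf{Lmap}^{r-1}\bigr)$$ and the tuple $$\bigl(\mathsf{sor},\mathsf{Cyc}^0,\mathsf{Cyc}^{r-1},\dots,\mathsf{Cyc}^{1},\mathsf{Lmic}^0,\mathsf{Lmic}^{r-1},\dots,\mathsf{Lmic}^1,\mathsf{Lmal}^0,\mathsf{Lmal}^{r-1},\dots,\mathsf{Lmal}^1,\mathsf{Lmap}^0,\mathsf{Lmap}^{r-1},\dots,\mathsf{Lmap}^1\bigr)$$ have the same joint distribution: for every possible value $v$, the number of $\pi\in\mathsf{G}_{r,n,\mathbf f}$ at which the first tuple equals $v$ equals the number of $\pi\in\mathsf{G}_{r,n,\mathbf f}$ at which the second tuple equals $v$.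
   Context: $\mathsf{G}_{r,n}=C_r\wr\mathfrak S_n$: pairs $(\sigma,\mathbf z)$, $\sigma\in\mathfrak S_n$, $\mathbf z\in(\mathbb Z/r)^n$, written $\pi=\sigma_1^{[z_1]}\cdots\sigma_n^{[z_n]}$ (colors in $\{0,\dots,r-1\}$, read mod $r$); product $(\sigma,\mathbf z)(\rho,\mathbf w)=(\sigma\rho,\mathbf w+\rho(\mathbf z))$ with $\rho(\mathbf z)=(z_{\rho(1)},\dots,z_{\rho(n)})$; $\pi$ acts on $\{i^{[t]}\}$ by $\pi(i^{[t]})=\sigma_i^{[z_i+t]}$, $i^{[0]}=i$. $\mathsf{G}_{r,n,\mathbf f}=\{(\sigma,\mathbf z)\in\mathsf{G}_{r,n}:\sigma(i)\le f_i\ \forall i\}$ (colored permutations on a Ferrers shape). $\ell(\pi)$: minimal number of factors in an expression of $\pi$ as a product of $s_0=1^{[1]}2\cdots n$ and $s_i$ ($1\le i<n$: base permutation $(i\ i+1)$, all colors $0$). $\mathsf{sor}(\pi)$ (sorting index): set $\pi^{(n)}=\pi$; for $j=n,\dots,1$ let $c_j$ be the position of the letter with base value $j$ in the length-$j$ word $\pi^{(j)}=\tau_1^{[y_1]}\cdots\tau_j^{[y_j]}$, $z$ its color, $e_j\in\{0,\dots,r-1\}$ with $e_j\equiv-z$; if $c_j<j$, $\pi^{(j-1)}$ is obtained by replacing the letter at position $c_j$ by $\tau_j^{[y_j-e_j]}$ and deleting the last letter; if $c_j=j$, by deleting the last letter. Then $\mathsf{sor}(\pi)=\sum_j\bigl(j-c_j+\chi(e_j>0)(2(c_j-1)+e_j)\bigr)$,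 $\chi$ the indicator. Statistics: $\mathsf{Rmil}(\pi)=\{\sigma_i^{[z_i]}:\sigma_i<\sigma_j\,\forall j>i\}$, $\mathsf{Lmil}(\pi)=\{\sigma_i^{[z_i]}:\sigma_i<\sigma_j\,\forall j<i\}$, $\mathsf{Lmal}(\pi)=\{\sigma_i^{[z_i]}:\sigma_i>\sigma_j\,\forall j<i\}$, $\mathsf{Lmap}(\pi)=\{i^{[z_i]}:\sigma_i>\sigma_j\,\forall j<i\}$; $\mathsf{Cyc}(\pi)$ = set of $\alpha^{[c]}$ over cycles of $\sigma$ with element set $B$, $\alpha=\min B$, $c\equiv\sum_{k\in B}z_k\pmod r$; $\mathsf{Lmic}(\pi)$ = set of letters of the word $\pi(1)\pi^2(1)\cdots\pi^m(1)$ ($m\ge1$ least with $\pi^m(1)=1$) whose base value is smaller than the base values of all earlier letters. For a set $S$ of colored letters, $S^t=\{k:k^{[t]}\in S\}$. *)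

(* Defs.v *)
From mathcomp Require Import all_boot all_fingroup.
Set Implicit Arguments. Unset Strict Implicit. Unset Printing Implicit Defensive.
Local Open Scope nat_scope.

Section ColPerm.
Variables (r n : nat).

(* Positions and base values are 0-indexed: paper's i in {1..n} is i-1 : 'I_n.
   Colors are elements of 'I_r (integers mod r). *)
Definition cperm := ({perm 'I_n} * {ffun 'I_n -> 'I_r})%type.

Definition base (p : cperm) (i : 'I_n) : 'I_n := p.1 i.
Definition col (p : cperm) (i : 'I_n) : nat := val (p.2 i).

Lemma ord_gt0 (a : 'I_r) : 0 < r.
Proof. exact: leq_ltn_trans (leq0n a) (ltn_ord a). Qed.

Definition cadd (a b : 'I_r) : 'I_r := Ordinal (ltn_pmod (a + b) (ord_gt0 a)).

Definition cneg (t : 'I_r) : 'I_r := Ordinal (ltn_pmod (r - t) (ord_gt0 t)).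

Definition cmul (p q : cperm) : cperm :=
  ((q.1 * p.1)%g, [ffun i => cadd (q.2 i) (p.2 (q.1 i))]).

Lemma cmul_base p q i : base (cmul p q) i = base p (base q i).
Proof. by rewrite /base /= permM. Qed.

Definition cone (r0 : 'I_r) : cperm := (1%g, [ffun _ => Ordinal (ltn_pmod 0 (ord_gt0 r0))]).

(* generators: index 0 is s_0 = 1^[1] 2 ... n ; index i >= 1 is s_i,
   base permutation the transposition of positions i and i+1 (1-indexed),
   i.e. of 0-indexed i-1 and i, all colors 0. *)
Definition gen (r0 : 'I_r) (i : 'I_n) : cperm :=
  if val i == 0 then
    (1%g, [ffun k : 'I_n => Ordinal (ltn_pmod (val k == 0 : nat) (ord_gt0 r0))])
  else
    (tperm (Ordinal (leq_ltn_trans (leq_pred i) (ltn_ord i))) i, [ffun _ => Ordinal (ltn_pmod 0 (ord_gt0 r0))]).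

Definition wordprod (r0 : 'I_r) (w : seq 'I_n) : cperm :=
  foldr (fun i acc => cmul (gen r0 i) acc) (cone r0) w.

Definition prodlen (p : cperm) (k : nat) : bool :=
  [exists r0 : 'I_r, exists w : k.-tuple 'I_n, wordprod r0 w == p].

(* length: least k with pi a product of k generators.  The search range
   0..#|G_{r,n}|-1 always contains a witness, since the generators generate
   the finite group G_{r,n} (Cayley graph diameter < #|G|). *)
Definition ell (p : cperm) : nat :=
  find (prodlen p) (iota 0 #|{: cperm}|).

(* a word is a seq of (base value, color) with base values 0..j-1 *)
Definition sor_step (w : seq (nat * nat)) : nat * seq (nat * nat) :=
  let j := size w in
  let c := index j.-1 (map fst w) in      (* paper: c_j = c+1 *)
  let z := (nth (0,0) w c).2 in
  let e := (r - z %% r) %% r in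
  let lst := last (0,0) w in
  let w' := if c.+1 < j then set_nth (0,0) w c (lst.1, (lst.2 + (r - e)) %% r)
            else w in
  ((j - c.+1) + (if 0 < e then 2 * c + e else 0), take j.-1 w').

Fixpoint sor_aux (k : nat) (w : seq (nat * nat)) : nat :=
  if k is k'.+1 then (sor_step w).1 + sor_aux k' (sor_step w).2 else 0.

Definition sor (p : cperm) : nat :=
  sor_aux n [seq (val (base p i), col p i) | i <- enum 'I_n].

(* ---------- set-valued statistics (S^t = {k : k^[t] in S}) ---------- *)
Definition Rmil (p : cperm) (t : 'I_r) : {set 'I_n} :=
  [set k | [exists i, [&& base p i == k, col p i == t &
            [forall j : 'I_n, (i < j) ==> (base p i < base p j)]]]].

Definition Lmil (p : cperm) (t : 'I_r) : {set 'I_n} :=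
  [set k | [exists i, [&& base p i == k, col p i == t &
            [forall j : 'I_n, (j < i) ==> (base p i < base p j)]]]].

Definition Lmal (p : cperm) (t : 'I_r) : {set 'I_n} :=
  [set k | [exists i, [&& base p i == k, col p i == t &
            [forall j : 'I_n, (j < i) ==> (base p j < base p i)]]]].

Definition Lmap (p : cperm) (t : 'I_r) : {set 'I_n} :=
  [set i | (col p i == t) && [forall j : 'I_n, (j < i) ==> (base p j < base p i)]].

Definition Cyc (p : cperm) (t : 'I_r) : {set 'I_n} :=
  [set a | [forall k in porbit p.1 a, a <= k] &&
           ((\sum_(k in porbit p.1 a) col p k) %% r == t)].

(* action on colored letters: pi(i^[t]) = sigma_i^[z_i + t] *)
Definition cact (p : cperm) (x : 'I_n * nat) : 'I_n * nat :=
  (base p x.1, (col p x.1 + x.2) %% r).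

(* Lmic: left-to-right minima (w.r.t. base value) of the word
   pi(1) pi^2(1) ... pi^m(1), m >= 1 least with pi^m(1) = 1 (= 1^[0]).
   m <= n*r always, so the search range suffices. *)
Definition Lmic (p : cperm) (t : 'I_r) : {set 'I_n} :=
  [set b | [exists s : 'I_n, (val s == 0) &&
    (let m := (find (fun k => iter k.+1 (cact p) (s, 0) == (s, 0)) (iota 0 (n * r))).+1 in
     [exists k : 'I_(n * r).+2,
        [&& 0 < k, k <= m, iter k (cact p) (s, 0) == (b, val t) &
            [forall k' : 'I_(n * r).+2, (0 < k' < k) ==>
                 (b < (iter k' (cact p) (s, 0)).1)]]])]].

Definition Gf (f : 'I_n -> nat) : {set cperm} :=
  [set p : cperm | [forall i, (val (base p i)).+1 <= f i]].

Definition statT := (nat * {ffun 'I_r -> {set 'I_n} * {set 'I_n} * {set 'I_n} * {set 'I_n}})%type.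

Definition stat1 (p : cperm) : statT :=
  (ell p, [ffun t => (Rmil p t, Lmil p t, Lmal p t, Lmap p t)]).

(* (sor, Cyc^{-t}, Lmic^{-t}, Lmal^{-t}, Lmap^{-t})_t : the t-th entry of each
   block is the statistic with color 0, r-1, ..., 1 *)
Definition stat2 (p : cperm) : statT :=
  (sor p, [ffun t => (Cyc p (cneg t), Lmic p (cneg t), Lmal p (cneg t), Lmap p (cneg t))]).

End ColPerm.

(* Main.v *)
Require Import Defs.
From mathcomp Require Import all_boot all_fingroup.
From mathcomp Require Import zify.

(** Encode a colored permutation by pairs (c_j, e_j) with c_j <= j, in two ways.
    Insertion: put the letter j, with color e_j, at position c_j of the word
    built so far.  Sorting: put the letter j, with color -e_j, at position c_j
    and move the displaced letter to position j with its color increased by e_j.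
    Both encodings are bijective, and l, resp. sor, is the sum of the same weights
    j - c_j + [e_j > 0] (2 c_j + e_j) (with 0-based c_j and j).  The letter j
    contributes to Rmil, resp. Cyc, iff c_j = j, and to Lmil, resp. Lmic, iff
    c_j = 0; it never affects the contribution of a smaller letter.  In both
    encodings, step j keeps the left-to-right maxima at positions < c_j, creates one
    at c_j and destroys the later ones, so the maxima agree up to the sign of the
    colors; these maxima also determine membership in G_{r,n,f}. *)

Set Implicit Arguments. Unset Strict Implicit. Unset Printing Implicit Defensive.

Section Colored.
Variables (r n : nat) (r0 : 'I_r).
Local Notation cp := (cperm r n.+1).
Implicit Types (p q : cp) (i j k c u v w : 'I_n.+1) (e t : 'I_r).

(** * The group of colored permutations and the negation of colors *)

Lemma r_gt0 : 0 < r. Proof. exact: ord_gt0 r0. Qed.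

Lemma col_lt p i : col p i < r. Proof. exact: ltn_ord. Qed.

Lemma base_inj p : injective (base p). Proof. exact: perm_inj. Qed.

Lemma base_eq p i j : (base p i == base p j) = (i == j).
Proof. exact: (inj_eq (base_inj (p := p))). Qed.

Lemma cpermP p q : (forall i, base p i = base q i) -> (forall i, col p i = col q i) -> p = q.
Proof.
case: p q => [s z] [s' z'] hb hc; congr pair; first exact/permP.
by apply/ffunP => i; apply: val_inj; apply: hc.
Qed.

Lemma col_cmul p q i : col (cmul p q) i = (col q i + col p (base q i)) %% r.
Proof. by rewrite /col ffunE. Qed.

Lemma base_cone i : base (cone n.+1 r0) i = i. Proof. by rewrite /base perm1. Qed.

Lemma col_cone i : col (cone n.+1 r0) i = 0. Proof. by rewrite /col ffunE /= mod0n. Qed.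

Lemma cmulA p q s : cmul p (cmul q s) = cmul (cmul p q) s.
Proof.
apply: cpermP => i; first by rewrite !cmul_base.
by rewrite !col_cmul !cmul_base modnDml modnDmr addnA.
Qed.

Lemma cmul1p p : cmul (cone n.+1 r0) p = p.
Proof.
apply: cpermP => i; first by rewrite cmul_base base_cone.
by rewrite col_cmul col_cone addn0 modn_small ?col_lt.
Qed.

Lemma cmulp1 p : cmul p (cone n.+1 r0) = p.
Proof.
apply: cpermP => i; first by rewrite cmul_base base_cone.
by rewrite col_cmul col_cone base_cone add0n modn_small ?col_lt.
Qed.

Lemma cmul_inj q : injective (fun p => cmul p q).
Proof.
move=> p p' /= E; have hb i : base p (base q i) = base p' (base q i).
  by rewrite -!cmul_base E.
have surj i : exists j, i = base q j by exists (q.1^-1%g i); rewrite /base permKV.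
apply: cpermP => i; have [j ->] := surj i; first exact: hb.
have := congr1 (fun x => col x j) E; rewrite /= !col_cmul.
by move/eqP; rewrite eqn_modDl !modn_small ?col_lt // => /eqP.
Qed.

Lemma val_cneg t : val (cneg t) = (r - t) %% r. Proof. by []. Qed.

Lemma cnegE t : (t + cneg t) %% r = 0.
Proof. by rewrite /= modnDmr subnKC ?modnn // ltnW. Qed.

Lemma cnegK : involutive (@cneg r).
Proof.
move=> t; apply: val_inj; rewrite /=; case: (posnP t) => [->|t0].
  by rewrite subn0 modnn subn0 modnn.
have tr := ltn_ord t; rewrite (modn_small (_ : r - t < r)); last by lia.
by rewrite subKn ?modn_small // ltnW.
Qed.

(** * Left-to-right maxima and the Ferrers shape *)

Definition lmax p i : bool := [forall j : 'I_n.+1, (j < i) ==> (base p j < base p i)].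

Lemma lmaxP p i : reflect (forall j, j < i -> base p j < base p i) (lmax p i).
Proof. by apply: (iffP forallP) => h j; [move/implyP: (h j) | apply/implyP/h]. Qed.

(** The largest value at positions up to i sits at a left-to-right maximum j <= i, and [f j <= f i],
    so the bound at j passes on to i. *)
Lemma mem_Gf (f : 'I_n.+1 -> nat) p : (forall i j, i <= j -> f i <= f j) ->
  (p \in @Gf r n.+1 f) = [forall i, lmax p i ==> (base p i < f i)].
Proof.
move=> fmono; rewrite inE; apply/forallP/forallP => h i; first by apply/implyP=> _; exact: h.
case: (@arg_maxnP _ i (fun j => j <= i) (base p) (leqnn i)) => j ji jmax.
have jM : lmax p j.
  apply/lmaxP => l lj; rewrite ltn_neqAle (inj_eq val_inj) base_eq.
  by rewrite neq_ltn lj; exact: jmax (leq_trans (ltnW lj) ji).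
have := h j; rewrite jM => /= hj.
exact: leq_ltn_trans (jmax i (leqnn i)) (leq_trans hj (fmono _ _ ji)).
Qed.

(** * Weights, stages and the elementary factors *)

Definition weight (k c e : nat) : nat := (k - c) + (if 0 < e then 2 * c + e else 0).

Lemma weight_lt (k c : nat) e : c <= k -> weight k c e < k.+1 * r.
Proof. move=> ck; have er := ltn_ord e; rewrite /weight; case: ifP => e0; nia. Qed.

(** Induction on (1 + s)(1 + t) > s + t. Applied to the weights and the factors of the group order,
    it places the length inside the search range of [ell]. *)
Lemma sum_lt_prod m (F G : nat -> nat) : (forall a, a < m -> F a < G a) ->
  \sum_(a < m) F a < \prod_(a < m) G a.
Proof.
elim: m => [|m IH] h; first by rewrite !big_ord0.
rewrite !big_ord_recr /=.
have h1 := IH (fun a am => h a (ltnW am)); have h2 := leq_mul h1 (h m (leqnn _)).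
by apply: leq_trans h2; rewrite mulSn mulnS addSn ltnS addnC leq_add2l leq_addr.
Qed.

(* Colored permutations of the first m positions, extended by the identity. *)
Definition stage (m : nat) p := forall i, m <= i -> base p i = i /\ col p i = 0.

Lemma stage_lt m p i : stage m p -> i < m -> base p i < m.
Proof.
move=> h im; rewrite ltnNge; apply/negP => hm.
have [/base_inj E _] := h _ hm; by rewrite E leqNgt im in hm.
Qed.

Lemma stage_lt_iff m p i : stage m p -> (base p i < m) = (i < m).
Proof.
move=> h; case: (ltnP i m) => [/(stage_lt h)-> //|hi].
by rewrite (h i hi).1 ltnNge hi.
Qed.

Lemma stage_cone : stage 0 (cone n.+1 r0).
Proof. by move=> i _; rewrite base_cone col_cone. Qed.

Definition uncolored : 'I_r := Ordinal r_gt0.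

(** Multiplied on the right of a p of stage k, it inserts the letter k with color e at position c:
    [lift_perm] sends c to k and is increasing on the other positions. *)
Definition ins k (ce : 'I_n.+1 * 'I_r) : cp :=
  (lift_perm ce.1 k 1, [ffun i => if i == ce.1 then ce.2 else uncolored]).

(** Multiplied on the right of a p of stage k, it undoes a sorting step: k comes to position c with
    color -e, the displaced letter goes to position k with e added. For c = k the first test wins
    and only -e is recorded. *)
Definition srt k (ce : 'I_n.+1 * 'I_r) : cp :=
  (tperm ce.1 k, [ffun i => if i == ce.1 then cneg ce.2 else if i == k then ce.2 else uncolored]).

Lemma base_ins k c e i : c <= k ->
  base (ins k (c, e)) i =
    (if i == c then val k else if c < i <= k then i.-1 else i) :> nat.
Proof.
move=> ck; rewrite /base /=; case: (unliftP c i) => [j ->|->].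
  rewrite lift_perm_lift eq_sym (negbTE (neq_lift c j)) perm1 /= /bump.
  case: j => j _ /=; case: (leqP k j) => ?; case: (leqP c j) => ?;
    by rewrite ?add1n ?add0n; case: ifP; lia.
by rewrite lift_perm_id eqxx.
Qed.

Lemma base_srt k c e i :
  base (srt k (c, e)) i = if i == c then k else if i == k then c else i.
Proof.
rewrite /base /=; case: tpermP => [->|->|/eqP/negbTE-> /eqP/negbTE->//]; rewrite eqxx //.
by case: eqP.
Qed.

Lemma col_ins k c e i : col (ins k (c, e)) i = if i == c then val e else 0.
Proof. by rewrite /col ffunE /=; case: eqP. Qed.

Lemma col_srt k c e i : col (srt k (c, e)) i =
  if i == c then val (cneg e) else if i == k then val e else 0.
Proof. by rewrite /col ffunE /=; do 2?case: eqP. Qed.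

(** * Codes and the products they define *)

Definition code := {ffun 'I_n.+1 -> 'I_n.+1 * 'I_r}.
Implicit Types d : code.

Definition valid d := [forall k, (d k).1 <= k].

Lemma card_cperm : #|{: cp}| = \prod_(k < n.+1) (k.+1 * r).
Proof.
rewrite card_prod card_ffun !card_ord card_Sn big_split /=.
rewrite prod_nat_const card_ord fact_prod; congr (_ * _).
by rewrite big_add1 big_mkord.
Qed.

Lemma card_valid : #|[set d | valid d]| = \prod_(k < n.+1) (k.+1 * r).
Proof.
pose F k := [pred ce : 'I_n.+1 * 'I_r | ce.1 <= k].
rewrite (_ : #|_| = #|(family F : simpl_pred code)|); last first.
  by apply: eq_card => d; rewrite inE.
rewrite card_family foldrE big_map big_enum /=.
apply: eq_bigr => k _.
have wi : injective (widen_ord (ltn_ord k)).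
  by move=> a b /(congr1 val) /= ab; apply: val_inj.
transitivity #|setX (widen_ord (ltn_ord k) @: setT) [set: 'I_r]|; last first.
  by rewrite cardsX card_imset // !cardsT !card_ord.
apply: eq_card => -[c e]; rewrite !inE /= andbT.
apply/idP/imsetP => [ck|[c' _ ->]]; last exact: (ltn_ord c').
by exists (Ordinal (ck : c < k.+1)) => //; apply: val_inj.
Qed.

Section Build.
Variable x : 'I_n.+1 -> 'I_n.+1 * 'I_r -> cp.

(** Generic in the factors [x], so that both encodings share the counting argument. [inord m'] is m'
    itself as long as m' <= n. *)
Fixpoint build d m : cp :=
  if m is m'.+1 then cmul (build d m') (x (inord m') (d (inord m'))) else cone n.+1 r0.

Hypothesis x_stage : forall k c e, c <= k -> stage k.+1 (x k (c, e)).
Hypothesis x_base : forall k c e, c <= k -> base (x k (c, e)) c = k.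
Hypothesis x_col : forall k c e e', c <= k ->
  col (x k (c, e)) c = col (x k (c, e')) c -> e = e'.

Lemma stage_step k c e p : c <= k -> stage k p -> stage k.+1 (cmul p (x k (c, e))).
Proof.
move=> ck hp i ki; have [hb hc] := x_stage e ck ki.
have [pb pc] := hp i (ltnW ki).
by rewrite cmul_base col_cmul hb hc pb pc mod0n.
Qed.

Lemma build_ind (P : nat -> cp -> Prop) d : valid d -> P 0 (cone n.+1 r0) ->
  (forall k c e p, c <= k -> d k = (c, e) -> stage k p -> P k p -> P k.+1 (cmul p (x k (c, e)))) ->
  forall m, m <= n.+1 -> P m (build d m) /\ stage m (build d m).
Proof.
move=> vd P0 PS; elim=> [|m IH] mn; first by split=> //; apply: stage_cone.
have [hP hs] := IH (ltnW mn).
pose k : 'I_n.+1 := inord m; have E : m = k by rewrite inordK.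
have := forallP vd k; rewrite /= -/k; case D: (d k) => [c e] /= ck.
move: hP hs; set p := build d m; rewrite E => hP hs.
by split; [apply: PS | apply: stage_step].
Qed.

Lemma build_stage d m : valid d -> m <= n.+1 -> stage m (build d m).
Proof.
by move=> vd mn;
  have [] := @build_ind (fun _ _ => True) d vd I (fun _ _ _ _ _ _ _ _ => I) m mn.
Qed.

(** The last factor sends c to its own index, which the earlier factors fix without color; so c is
    the position of that letter, and its color determines e. Cancelling the equal last factors
    leaves shorter products. *)
Lemma build_inj d d' m : valid d -> valid d' -> m <= n.+1 -> build d m = build d' m ->
  forall k, k < m -> d k = d' k.
Proof.
move=> vd vd'; elim: m => [//|m IH] mn /= E k km.
have Em : m = @inord n m by rewrite inordK.
have := forallP vd (inord m); have := forallP vd' (inord m); move: E.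
case D: (d _) => [c e]; case D': (d' _) => [c' e'] /= E ck' ck.
have hs := build_stage vd (ltnW mn); have hs' := build_stage vd' (ltnW mn).
move: E; rewrite Em in hs hs' => E.
have [hb hc] := hs (inord m) (leqnn _); have [hb' hc'] := hs' (inord m) (leqnn _).
rewrite -Em in hb hc hb' hc'.
have cc : c = c'.
  apply: (@base_inj (cmul (build d m) (x (inord m) (c, e)))).
  by rewrite {2}E !cmul_base !x_base // hb hb'.
subst c'; have ee : e = e'.
  have := congr1 (fun q => col q c) E; rewrite /= !col_cmul !x_base // hc hc' !addn0.
  by rewrite !modn_small ?col_lt // => /(x_col ck).
subst e'; move: km; rewrite ltnS leq_eqVlt => /orP[/eqP km|km].
  have -> : k = inord m by apply: val_inj; rewrite /= -Em.
  by rewrite D D'.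
by apply: IH => //; [exact: ltnW | exact: cmul_inj E].
Qed.

(** [build] is injective on valid codes, and these are as many as the colored permutations, so it is
    bijective. *)
Lemma card_build (P : pred cp) :
  #|[set p | P p]| = #|[set d | valid d && P (build d n.+1)]|.
Proof.
have bi : {in [set d | valid d] &, injective (fun d => build d n.+1)}.
  move=> d d'; rewrite !inE => vd vd' E; apply/ffunP => k.
  exact: (build_inj vd vd' (leqnn _) E (ltn_ord k)).
have onto : (fun d => build d n.+1) @: [set d | valid d] = setT.
  by apply/eqP; rewrite eqEcard subsetT cardsT card_in_imset // card_cperm card_valid leqnn.
rewrite -(card_in_imset (f := fun d => build d n.+1)); last first.
  by move=> d d'; rewrite !inE => /andP[vd _] /andP[vd' _]; apply: bi; rewrite inE.
apply: eq_card => p; rewrite inE; apply/idP/imsetP => [Pp|[d]]; last first.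
  by rewrite inE => /andP[_ ?] ->.
have: p \in [set: cp] by [].
rewrite -onto => /imsetP[d]; rewrite inE => vd E.
by exists d => //; rewrite inE vd -E.
Qed.

(** Step v decides the membership of v from its own code entry, and no later step changes it. [b]
    tests the position; [g] is the sign convention for colors. *)
Lemma mem_build (S : cp -> 'I_r -> {set 'I_n.+1}) (b : rel 'I_n.+1) (g : 'I_r -> 'I_r) :
  (forall k c e p, c <= k -> stage k p -> forall t v, v <= k ->
    (v \in S (cmul p (x k (c, e))) t) =
      if v == k then b c k && (g e == t) else v \in S p t) ->
  forall d t v, valid d ->
    (v \in S (build d n.+1) t) = b (d v).1 v && (g (d v).2 == t).
Proof.
move=> step d t v vd.
have [] // := @build_ind (fun m p => forall v, v < m ->
  (v \in S p t) = b (d v).1 v && (g (d v).2 == t)) d vd _ _ n.+1 (leqnn _).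
  move=> k c e p ck dk hp IH u; rewrite ltnS => uk.
  rewrite step //; case: eqVneq => [->|nuk]; first by rewrite dk.
  by apply: IH; rewrite ltn_neqAle uk andbT (inj_eq val_inj).
by move=> h _; apply: h.
Qed.

End Build.

(** * Length *)

(* The pair formed by j and a smaller letter i counts 1 if i is to the right of j;
   otherwise it counts 2 if j is colored and 0 if not. *)
Definition inv_at p j : nat :=
  col p j + \sum_(i | base p i < base p j) (if j < i then 1 else if 0 < col p j then 2 else 0).

Definition len p : nat := \sum_j inv_at p j.

(** The form [1 %% r] covers r = 1, where s_0 is the identity. *)
Lemma col_gen i j : col (gen r0 i) j = if (val i == 0) && (val j == 0) then 1 %% r else 0.
Proof.
rewrite /gen; case: ifP => _; rewrite /col ffunE /= ?mod0n //.
by case: eqP => // _; rewrite mod0n.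
Qed.

Lemma base_gen0 i : base (gen r0 ord0) i = i.
Proof. by rewrite /base /gen /= perm1. Qed.

Lemma base_genS u w i : w = u.+1 :> nat -> base (gen r0 w) i = tperm u w i.
Proof.
move=> wu; rewrite /base /gen /= {1}wu /=; congr (tperm _ _ _).
by apply: val_inj; rewrite /= wu.
Qed.

Lemma len_cone : len (cone n.+1 r0) = 0.
Proof.
rewrite /len big1 // => j _; rewrite /inv_at col_cone big1 // => i.
by rewrite !base_cone ltnNge => /negbTE h; case: ltnP => // /ltnW; rewrite h.
Qed.

(** Only the pair at positions u, w changes order. Its charge goes from 2 or 0, with the larger
    letter on the right, to 1, with the larger letter on the left. *)
Lemma len_swap p u w : w = u.+1 :> nat -> base p u < base p w ->
  len (cmul p (gen r0 w)) + (if 0 < col p w then 2 else 0) = (len p).+1.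
Proof.
move=> wu puw; set q := cmul _ _; pose s := tperm u w.
have qb i : base q i = base p (s i) by rewrite cmul_base (base_genS _ wu).
have qc i : col q i = col p (s i).
  by rewrite col_cmul (base_genS _ wu) col_gen /= wu /= add0n modn_small ?col_lt.
have sv i : s i = (if i == u then val w else if i == w then val u else val i) :> nat.
  by rewrite /s; case: tpermP => [->|->|/eqP/negbTE-> /eqP/negbTE->//]; rewrite eqxx //;
    case: eqP => [->|].
(* The letter at position j of p stands at position [s j] of q, so the sums are reindexed by [s]. *)
have qT j : inv_at q (s j) = col p j +
    \sum_(i | base p i < base p j) (if s j < s i then 1 else if 0 < col p j then 2 else 0).
  rewrite /inv_at qc qb tpermK; congr (_ + _).
  rewrite (reindex_inj (@perm_inj _ s)).
  by apply: eq_big => i; rewrite ?qb tpermK.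
rewrite /len (reindex_inj (@perm_inj _ s)) (bigD1 w) //= [in RHS](bigD1 w) //=.
(* For j other than w, the order with a smaller letter at i could change only if j = u and i = w,
   which [base p u < base p w] excludes. *)
have -> : \sum_(j | j != w) inv_at q (s j) = \sum_(j | j != w) inv_at p j.
  apply: eq_bigr => j jw; rewrite qT; congr (_ + _); apply: eq_bigr => i ij.
  have -> // : (s j < s i) = (j < i).
  have ji : j != i by apply: contraTneq ij => ->; rewrite ltnn.
  have juiw : ~~ ((j == u) && (i == w)).
    by apply: contraTN ij => /andP[/eqP-> /eqP->]; rewrite -leqNgt ltnW.
  rewrite !sv; move: ji jw juiw; rewrite -!(inj_eq val_inj) /= wu.
  by move=> *; repeat case: eqP; lia.
have sw : s w = u by rewrite /s tpermR.
rewrite sw.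
suff H : inv_at q u + (if 0 < col p w then 2 else 0) = (inv_at p w).+1 by rewrite addnAC H.
rewrite -[u in LHS](tpermR u w) qT /inv_at (bigD1 u) //= [in RHS](bigD1 u) //=.
have su : s u = w by rewrite /s tpermL.
rewrite sw su.
have -> : (u < w) = true by lia.
have -> : (w < u) = false by lia.

set X := bigop _ _ _; set Y := bigop _ _ _.
suff -> : X = Y. lia.
apply: eq_bigr => i /andP[iw iu].
have -> // : (u < s i) = (w < i).
have : i != w by apply: contraTneq iw => ->; rewrite ltnn.
rewrite sv (negbTE iu); move: iu; rewrite -!(inj_eq val_inj) /= wu.
by repeat case: eqP; lia.
Qed.

Lemma gen_invol u w p : w = u.+1 :> nat -> cmul (cmul p (gen r0 w)) (gen r0 w) = p.
Proof.
move=> wu; apply: cpermP => i.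
  by rewrite !cmul_base !(base_genS _ wu) tpermK.
rewrite !col_cmul !(base_genS _ wu) !col_gen /= wu /= tpermK.
by rewrite !add0n modn_mod modn_small ?col_lt.
Qed.

(** No letter stands to the left of position 0, so no pair is charged 2 and the color enters only
    additively. *)
Lemma inv_at_ord0 p : inv_at p ord0 = col p ord0 + \sum_(i | base p i < base p ord0) 1.
Proof.
rewrite /inv_at; congr (_ + _); apply: eq_bigr => i; case: (posnP i) => // i0.
by rewrite (_ : i = ord0) ?ltnn //; apply: val_inj.
Qed.

Lemma len_gen0 p q : (forall i, base p i = base q i) ->
  (forall i, i != ord0 -> col p i = col q i) ->
  len p + col q ord0 = len q + col p ord0.
Proof.
move=> hb hc; rewrite /len (bigD1 ord0) //= [in RHS](bigD1 ord0) //= !inv_at_ord0.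
have -> : \sum_(i | base p i < base p ord0) 1 = \sum_(i | base q i < base q ord0) 1.
  by apply: eq_bigl => i; rewrite !hb.
have -> : \sum_(i | i != ord0) inv_at p i = \sum_(i | i != ord0) inv_at q i.
  apply: eq_bigr => i i0; rewrite /inv_at hc //; congr (_ + _).
  by apply: eq_bigl => j; rewrite !hb.
by move: (bigop _ _ _) (bigop _ _ _) => X Y; lia.
Qed.

(** s_0 raises the first color by 1 or wraps it to 0; any other generator changes the charge of a
    single pair by one. Hence [len] bounds the size of every word from below. *)
Lemma len_gen p i : len (cmul p (gen r0 i)) <= (len p).+1.
Proof.
case: (posnP i) => [i0|i0].
  have -> : i = ord0 by apply: val_inj.
  have := @len_gen0 (cmul p (gen r0 ord0)) p.
  rewrite col_cmul col_gen base_gen0 /= modnDml add1n.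
  have := leq_mod (col p ord0).+1 r => h1 h2.
  suff : len (cmul p (gen r0 ord0)) + col p ord0 = len p + (col p ord0).+1 %% r by lia.
  apply: h2 => [j|j j0]; first by rewrite cmul_base base_gen0.
  by rewrite col_cmul base_gen0 col_gen (negbTE (j0 : val j != 0)) add0n modn_small ?col_lt.
have iu : i = (Ordinal (leq_ltn_trans (leq_pred i) (ltn_ord i))).+1 :> nat by rewrite /= prednK.
move: (Ordinal _) iu => u iu.
have [h|h|/val_inj/base_inj h] := ltngtP (base p u) (base p i); last by rewrite h in iu; lia.
  by have := len_swap iu h; lia.
(* At a descent, [len_swap] is applied to the swapped permutation, and swapping back gives p. *)
have h' : base (cmul p (gen r0 i)) u < base (cmul p (gen r0 i)) i.
  by rewrite !cmul_base !(base_genS _ iu) tpermL tpermR.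
have := len_swap iu h'; rewrite (gen_invol _ iu); case: ifP; lia.
Qed.

Lemma wordprod_rcons (s : seq 'I_n.+1) i :
  wordprod r0 (rcons s i) = cmul (wordprod r0 s) (gen r0 i).
Proof. by elim: s => [|j s IH] /=; [rewrite cmulp1 cmul1p | rewrite IH cmulA]. Qed.

Lemma len_wordprod (s : seq 'I_n.+1) : len (wordprod r0 s) <= size s.
Proof.
elim/last_ind: s => [|s i IH]; first by rewrite len_cone.
by rewrite wordprod_rcons size_rcons (leq_trans (len_gen _ _)).
Qed.

Lemma homo_perm_id (s : {perm 'I_n.+1}) :
  (forall u w, w = u.+1 :> nat -> s u < s w) -> forall i, s i = i.
Proof.
move=> h i.
have le m j : j = m :> nat -> j <= s j.
  elim: m j => [|m IH] j jm; first by rewrite jm.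
  have mn : m < n.+1 by rewrite (leq_trans _ (ltn_ord j)) // jm.
  by rewrite jm (leq_ltn_trans (IH (Ordinal mn) erefl)) // h.
(* As s permutes the indices, summing [j <= s j] gives equal totals, which forces equality in every
   term. *)
have := leqif_sum (fun j (_ : true) => leqif_eq (le j j erefl)).
rewrite /leqif (reindex_inj (@perm_inj _ s)) eqxx => -[_ /esym/forallP/(_ i)/=].
by move=> /eqP E; apply: val_inj.
Qed.

(** A positive color at position 0 is lowered by s_0. Otherwise an adjacent pair is swapped whose
    larger letter is colored and on the right (charge 2 drops to 1) or uncolored and on the left (1
    drops to 0). Without such a pair, p is the identity. *)
Lemma len_descent p :
  p = cone n.+1 r0 \/ exists i q, len p = (len q).+1 /\ p = cmul q (gen r0 i).
Proof.
case: (posnP (col p ord0)) => [p0|p0]; last first.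
  have lt : (col p ord0).-1 < r by rewrite (leq_ltn_trans (leq_pred _)) ?col_lt.
  pose q : cp := (p.1, [ffun i => if i == ord0 then Ordinal lt else p.2 i]).
  have q0 : col q ord0 = (col p ord0).-1 by rewrite /col ffunE eqxx.
  have qS i : i != ord0 -> col q i = col p i by move=> /negbTE i0; rewrite /col ffunE i0.
  right; exists ord0, q; split.
    have := @len_gen0 p q (fun _ => erefl) (fun i hi => esym (qS i hi)).
    by rewrite q0; lia.
  apply: cpermP => i; first by rewrite cmul_base base_gen0.
  rewrite col_cmul base_gen0 col_gen /=; case: (eqVneq i ord0) => [->|i0] /=.
    by rewrite q0 modnDml add1n prednK // modn_small ?col_lt.
  by rewrite (negbTE (i0 : val i != 0)) qS // add0n modn_small ?col_lt.
have [/existsP[w /existsP[u /andP[/eqP wu uw]]]|no] :=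
  boolP [exists w : 'I_n.+1, exists u : 'I_n.+1,
  (w == u.+1 :> nat) && (if base p u < base p w then 0 < col p w else col p u == 0)].
  right; exists w, (cmul p (gen r0 w)); rewrite (gen_invol _ wu); split=> //.
  case: ltnP uw => [h cw|h /eqP cu].
    by have := len_swap wu h; rewrite cw; lia.
  have h' : base (cmul p (gen r0 w)) u < base (cmul p (gen r0 w)) w.
    rewrite !cmul_base !(base_genS _ wu) tpermL tpermR ltn_neqAle h andbT.
    by rewrite (inj_eq val_inj) base_eq -(inj_eq val_inj) /= wu; lia.
  have := len_swap wu h'; rewrite (gen_invol _ wu) col_cmul (base_genS _ wu) tpermR cu.
  by rewrite col_gen /= wu mod0n addn0 => ->.
(* Color 0 propagates from u to w and forces an ascent; starting at position 0, all colors vanish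
   and the base permutation increases. *)
have asc u w : w = u.+1 :> nat -> col p u = 0 -> base p u < base p w /\ col p w = 0.
  move=> wu cu; move: no; rewrite negb_exists => /forallP/(_ w).
  rewrite negb_exists => /forallP/(_ u); rewrite wu eqxx cu eqxx /=.
  by case: ifP => // _; case: (col p w).
have cp0 m i : i = m :> nat -> col p i = 0.
  elim: m i => [|m IH] i im; first by rewrite -p0; congr col; apply: val_inj.
  have mn : m < n.+1 by rewrite (leq_trans _ (ltn_ord i)) // im.
  by have [] := asc (Ordinal mn) i im (IH (Ordinal mn) erefl).
left; apply: cpermP => i; last by rewrite col_cone (cp0 _ i erefl).
rewrite base_cone; apply: homo_perm_id => u w wu.
by have [] := asc u w wu (cp0 _ u erefl).
Qed.

Lemma wordprod_len p : exists2 s, size s = len p & wordprod r0 s = p.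
Proof.
move: {-1}(len p) (erefl (len p)) => m; elim: m p => [|m IH] p pm.
  exists [::] => //; case: (len_descent p) => [-> //|[i [q [E _]]]].
  by rewrite E in pm.
case: (len_descent p) => [E|[i [q [E ->]]]]; first by rewrite E len_cone in pm.
have [|s sm <-] := IH q; first by move: pm; rewrite E => -[].
by exists (rcons s i); rewrite ?size_rcons ?sm ?wordprod_rcons.
Qed.

(** The color argument only witnesses r > 0; the one chosen inside [prodlen] may differ from
    [r0]. *)
Lemma wordprod_irr (r1 : 'I_r) (s : seq 'I_n.+1) : wordprod r1 s = wordprod r0 s.
Proof.
have g i : gen r1 i = gen r0 i.
  by rewrite /gen; case: ifP => _; congr pair; apply/ffunP => j; rewrite !ffunE; apply: val_inj.
elim: s => [|i s IH] /=; last by rewrite g IH.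
by congr pair; apply/ffunP => j; rewrite !ffunE; apply: val_inj.
Qed.

Lemma prodlen_len p : prodlen p (len p).
Proof.
have [s sm sp] := wordprod_len p.
by apply/existsP; exists r0; apply/existsP; exists (tcast sm (in_tuple s)); rewrite val_tcast sp.
Qed.

Lemma prodlen_ge p m : prodlen p m -> len p <= m.
Proof.
case/existsP => r1 /existsP[s /eqP <-]; rewrite wordprod_irr.
by rewrite -{2}(size_tuple s) len_wordprod.
Qed.

(** A failed [find] would return the size of its range; the bound puts the witness [len p] within
    that range. *)
Lemma ell_len p : len p < #|{: cp}| -> ell p = len p.
Proof.
move=> bound; set N := #|_| in bound.
have le : ell p <= len p.
  rewrite leqNgt; apply/negP => /(before_find 0).
  by rewrite nth_iota // add0n prodlen_len.
apply/eqP; rewrite eqn_leq le /= prodlen_ge //.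
have lt : ell p < N by apply: leq_ltn_trans bound.
have := @nth_find _ 0 (prodlen p) (iota 0 N).
rewrite has_find size_iota => /(_ lt).
by rewrite nth_iota // add0n.
Qed.

(** * Length under insertion *)

Lemma sum_code_step (m c h : nat) : c <= m ->
  \sum_(y < m) (if c <= y then 1 else h) = (m - c) + c * h.
Proof.
elim: m => [|m IH] cm; first by rewrite big_ord0; move: cm; rewrite leqn0 => /eqP->.
rewrite big_ord_recr /=; move: cm; rewrite leq_eqVlt => /orP[/eqP->|cm].
  rewrite (eq_bigr (fun=> h)); last by move=> i _; rewrite ltnNge (ltnW (ltn_ord i)).
  by rewrite sum_nat_const card_ord ltnn subnn mulSn addnC.
by rewrite ltnS in cm; rewrite IH // cm subSn // addnAC addn1.
Qed.

(** The letter k exceeds the others at positions up to k: the k - c on its right count 1 each, the c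
    on its left count 2 each if e > 0, and its color adds e. Other contributions are unchanged. *)
Lemma len_ins k c e p : c <= k -> stage k p ->
  len (cmul p (ins k (c, e))) = len p + weight k c e.
Proof.
move=> ck hp; set q := cmul _ _; pose a := (ins k (c, e)).1.
have qb i : base q i = base p (a i) by rewrite cmul_base.
have av i : a i = (if i == c then val k else if c < i <= k then i.-1 else i) :> nat.
  exact: base_ins.
have ac : a c = k by apply: val_inj; rewrite /= av eqxx.
have [kb kc] := hp k (leqnn k).
have qc i : col q i = if i == c then val e else col p (a i).
  rewrite col_cmul col_ins; case: eqP => [->|_].
    by rewrite [base _ c]ac kc addn0 modn_small ?ltn_ord.
  by rewrite add0n modn_small ?col_lt.
rewrite /len [in RHS](reindex_inj (@perm_inj _ a)) (bigD1 c) //= [in RHS](bigD1 c) //=.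
(* In p the letter k is uncolored and all smaller letters are on its left. *)
have -> : inv_at p (a c) = 0.
  rewrite /inv_at ac kc kb big1 // => i.
  by rewrite (stage_lt_iff _ hp) => ik; rewrite ltnNge (ltnW ik).
have -> : inv_at q c = weight k c e.
  rewrite /inv_at qc eqxx; set h := if 0 < e then 2 else 0.
  rewrite (eq_big (fun i => a i < k) (fun i => if c <= a i then 1 else h)).
  - transitivity (e + \sum_(i < n.+1 | i < k) (if c <= i then 1 else h)).
      by rewrite [in RHS](reindex_inj (@perm_inj _ a)).
    rewrite -(big_ord_widen n.+1 (fun y => if c <= y then 1 else h)) ?sum_code_step //;
      last exact: ltnW.
    by rewrite /weight /h; case: ifP; lia.
  - by move=> i; rewrite !qb ac kb (stage_lt_iff _ hp).
  move=> i; rewrite !qb ac kb (stage_lt_iff _ hp) => h1.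
  have -> // : (c < i) = (c <= a i).
  by move: h1; rewrite av -(inj_eq val_inj) /=; do 2?case: ifP; lia.
rewrite add0n addnC; congr (_ + _); apply: eq_bigr => x xc.
rewrite /inv_at qc (negbTE xc) qb [in RHS](reindex_inj (@perm_inj _ a)); congr (_ + _).
apply: eq_big => [i|i]; rewrite !qb // => h1.
have -> // : (x < i) = (a x < a i).
(* [a] is increasing away from c. The case i = c arises only for x beyond k, to the right of both
   the old and the new place of the letter k. *)
have : ~~ ((i == c) && (a x <= k)).
  apply: contraTN h1 => /andP[/eqP-> axk]; rewrite ac kb -leqNgt.
  rewrite leq_eqVlt in axk; case/orP: axk => [/eqP/val_inj->|axk]; first by rewrite kb.
  by rewrite ltnW // (stage_lt hp).
have : x != i by apply: contraTneq h1 => ->; rewrite ltnn.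
rewrite !av (negbTE xc); move: xc; rewrite -!(inj_eq val_inj) /=.
by do ![case: ifP]; lia.
Qed.

Lemma ins_stage k c e : c <= k -> stage k.+1 (ins k (c, e)).
Proof.
move=> ck i ki; split.
  apply: val_inj; rewrite /= base_ins // -(inj_eq val_inj) /=.
  by do 2?case: ifP; lia.
by rewrite col_ins -(inj_eq val_inj) /=; case: ifP; lia.
Qed.

Lemma ins_base k c e : c <= k -> base (ins k (c, e)) c = k.
Proof. by move=> ck; apply: val_inj; rewrite /= base_ins // eqxx. Qed.

Lemma ins_col k c e e' : c <= k ->
  col (ins k (c, e)) c = col (ins k (c, e')) c -> e = e'.
Proof. by rewrite !col_ins eqxx => _ /val_inj. Qed.

Lemma srt_stage k c e : c <= k -> stage k.+1 (srt k (c, e)).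
Proof.
move=> ck i ki; rewrite base_srt col_srt.
have -> : (i == c) = false by rewrite -(inj_eq val_inj) /=; lia.
by have -> : (i == k) = false by rewrite -(inj_eq val_inj) /=; lia.
Qed.

Lemma srt_base k c e : c <= k -> base (srt k (c, e)) c = k.
Proof. by rewrite base_srt eqxx. Qed.

Lemma srt_col k c e e' : c <= k ->
  col (srt k (c, e)) c = col (srt k (c, e')) c -> e = e'.
Proof. by rewrite !col_srt eqxx => _ /val_inj/(can_inj cnegK). Qed.

Definition code_weight d (a : nat) : nat :=
  weight a (d (inord a)).1 (d (inord a)).2.

Lemma len_build d m : valid d -> m <= n.+1 ->
  len (build ins d m) = \sum_(a < m) code_weight d a.
Proof.
move=> vd mn.
have [] // := @build_ind _ ins_stage
  (fun m p => len p = \sum_(a < m) code_weight d a) d vd _ _ m mn.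
  by rewrite len_cone big_ord0.
move=> k c e p ck dk hp E; rewrite len_ins // E big_ord_recr /=; congr (_ + _).
by rewrite /code_weight inord_val dk.
Qed.

Lemma ell_build d : valid d -> ell (build ins d n.+1) = \sum_(a < n.+1) code_weight d a.
Proof.
move=> vd; rewrite ell_len len_build // card_cperm.
apply: (sum_lt_prod (F := code_weight d) (G := fun a => a.+1 * r)) => a an.
rewrite /code_weight; apply: weight_lt.
by have := forallP vd (inord a); rewrite inordK.
Qed.

(** * The sorting index *)

Definition word p : seq (nat * nat) := [seq (val (base p i), col p i) | i <- enum 'I_n.+1].

Lemma size_word p : size (word p) = n.+1.
Proof. by rewrite size_map size_enum_ord. Qed.

Lemma nth_word p i : nth (0, 0) (word p) i = (val (base p i), col p i).
Proof. by rewrite (nth_map i) ?size_enum_ord // nth_ord_enum. Qed.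

(** The sorting step finds k at position c with color -e, recovers e, and moves the last letter back
    to c with e subtracted, which reverses the factor [srt k (c, e)]. *)
Lemma sor_step_srt k c e q : c <= k -> stage k q ->
  sor_step r (take k.+1 (word (cmul q (srt k (c, e))))) = (weight k c e, take k (word q)).
Proof.
move=> ck hq; set p := cmul _ _; have [kb kc] := hq k (leqnn k).
have pb i : base p i = base q (if i == c then k else if i == k then c else i).
  by rewrite cmul_base base_srt.
have pcc : col p c = val (cneg e).
  by rewrite col_cmul base_srt col_srt eqxx kc addn0 modn_small ?ltn_ord.
have pck : c != k -> col p k = (e + col q c) %% r.
  by rewrite eq_sym => /negbTE h; rewrite col_cmul base_srt col_srt eqxx h.
have pi i : i != c -> i != k -> base p i = base q i /\ col p i = col q i.
  move=> /negbTE ic /negbTE ik.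
  by rewrite col_cmul pb base_srt col_srt ic ik add0n modn_small ?col_lt.
set w := take _ _.
have sw : size w = k.+1 by rewrite size_takel // size_word.
have nw i : i <= k -> nth (0, 0) w i = (val (base p i), col p i).
  by move=> ik; rewrite nth_take // nth_word.
have ic : index (val k) (map fst w) = c.
  have {1}-> : val k = nth 0 (map fst w) c.
    by rewrite (nth_map (0, 0)) ?sw // nw //= pb eqxx kb.
  apply: index_uniq; first by rewrite size_map sw.
  rewrite /w map_take take_uniq // -map_comp map_inj_uniq ?enum_uniq //.
  by move=> i j /= /val_inj/base_inj.
have skw : size (take k (word q)) = k by rewrite size_take size_word ltn_ord.
rewrite /sor_step sw /= ic nw // pcc /=.
have -> : (r - (r - e) %% r %% r) %% r = e.
  by have /(congr1 val) := cnegK e; rewrite /= modn_mod.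
have -> : last (0, 0) w = (val (base p k), col p k) by rewrite -nth_last sw /= nw.
congr pair.
apply: (@eq_from_nth _ (0, 0)) => [|a].
  rewrite skw ltnS; case: ifP => _; last by rewrite size_takel // sw.
  by rewrite size_takel // size_set_nth sw leq_max leqnSn orbT.
set w' := if _ then _ else _; rewrite (_ : size _ = k); last first.
  rewrite /w' ltnS; case: ifP => _;
    first by rewrite size_takel // size_set_nth sw leq_max leqnSn orbT.
  by rewrite size_takel // sw.
move=> ik; have [i Ei] : {i : 'I_n.+1 | a = i} by exists (Ordinal (ltn_trans ik (ltn_ord k))).
rewrite !nth_take //; move: ik; rewrite {a}Ei nth_word /w' ltnS => ik.
have ink : i != k by rewrite -(inj_eq val_inj) /= neq_ltn ik.
(* For c = k the last letter is k itself and is merely dropped. *)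
case: ltnP => [ck'|kc']; last first.
  have Ec : c = k by apply/val_inj/eqP; rewrite eqn_leq ck.
  by rewrite nw ?(ltnW ik) //; have [| |-> ->] := pi i; rewrite ?Ec.
have cnk : c != k by rewrite -(inj_eq val_inj) /= neq_ltn ck'.
rewrite nth_set_nth /= (inj_eq val_inj); case: eqP => [->|/eqP inc].
  rewrite pb eq_sym (negbTE cnk) eqxx pck //; congr pair.
  by rewrite modnDml addnAC subnKC ?(ltnW (ltn_ord e)) // modnDl modn_small ?col_lt.
by rewrite nw ?(ltnW ik) //; have [| |-> ->] := pi i.
Qed.

Lemma sor_build d : valid d -> sor (build srt d n.+1) = \sum_(a < n.+1) code_weight d a.
Proof.
move=> vd.
have [] // := @build_ind _ srt_stage
  (fun m q => sor_aux r m (take m (word q)) = \sum_(a < m) code_weight d a) d vd _ _ n.+1 (leqnn _).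
- by rewrite big_ord0.
- move=> k c e p ck dk hp E.
  have -> s : sor_aux r k.+1 s = (sor_step r s).1 + sor_aux r k (sor_step r s).2 by [].
  by rewrite sor_step_srt //= E big_ord_recr /= addnC /code_weight inord_val dk.
by rewrite take_oversize ?size_word.
Qed.

(** * Set-valued statistics *)

(** Abstracts the condition on positions, so that [Rmil] and [Lmil] share one insertion argument. *)
Definition picks (P : pred 'I_n.+1) p t : {set 'I_n.+1} :=
  [set v | [exists i, [&& base p i == v, col p i == t & P i]]].

Lemma mem_picks P p t i : (base p i \in picks P p t) = (col p i == t) && P i.
Proof.
rewrite inE; apply/existsP/andP => [[j /and3P[/eqP/base_inj-> -> ->]] //|[h1 h2]].
by exists i; rewrite eqxx h1 h2.
Qed.

Lemma base_surj p v : exists i, base p i = v.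
Proof. by exists (p.1^-1%g v); rewrite /base permKV. Qed.

(** * Right-to-left and left-to-right minima under insertion *)

Section Ins.
Variables (k c : 'I_n.+1) (e : 'I_r) (p : cp).
Hypotheses (ck : c <= k) (hp : stage k p).
Let a := (ins k (c, e)).1.
Let p' := cmul p (ins k (c, e)).

Let av i : a i = (if i == c then val k else if c < i <= k then i.-1 else i) :> nat.
Proof. exact: base_ins. Qed.

Let bp' i : base p' i = base p (a i).
Proof. exact: cmul_base. Qed.

Lemma base_ins_c : base p' c = k.
Proof. by rewrite cmul_base ins_base //; case: (hp (leqnn k)). Qed.

Lemma col_ins_c : col p' c = e.
Proof.
rewrite col_cmul ins_base // col_ins eqxx (hp (leqnn k)).2.
by rewrite addn0 modn_small ?ltn_ord.
Qed.

Lemma col_ins_neq i : i != c -> col p' i = col p (a i).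
Proof. by move=> /negbTE ic; rewrite col_cmul col_ins ic add0n modn_small ?col_lt. Qed.

Let stage_p' : stage k.+1 p'.
Proof. exact: (stage_step ins_stage e ck hp). Qed.

Let a_c : a c = k.
Proof. by apply: val_inj; rewrite /= av eqxx. Qed.

Let a_mono i j : i != c -> i < j -> a i < a j.
Proof.
move=> ic ij; rewrite !av (negbTE ic); move: ic; rewrite -!(inj_eq val_inj) /=.
by do ![case: ifP]; lia.
Qed.

Let a_mono_inv i j : i != c -> j != c -> a i < a j -> i < j.
Proof.
move=> ic jc; rewrite !av (negbTE ic) (negbTE jc); move: ic jc; rewrite -!(inj_eq val_inj) /=.
by do ![case: ifP]; lia.
Qed.

Lemma picks_ins (P P' : pred 'I_n.+1) (b : bool) t v : v <= k ->
  P' c = b -> (forall i, i != c -> base p (a i) < k -> P' i = P (a i)) ->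
  (v \in picks P' p' t) = if v == k then b && (e == t) else v \in picks P p t.
Proof.
move=> vk Pc Pi; have [i Ei] := base_surj p' v; rewrite -{1}Ei mem_picks.
case: (eqVneq i c) Ei => [->|ic] Ei.
  by rewrite -Ei base_ins_c eqxx col_ins_c Pc andbC.
have vnk : v != k by rewrite -Ei -base_ins_c base_eq.
rewrite (negbTE vnk) -Ei bp' mem_picks col_ins_neq // Pi //.
by rewrite -bp' Ei ltn_neqAle vk andbT.
Qed.

(** For c < k a smaller letter follows k; for c = k only larger fixed letters do. Smaller letters
    keep their relative order and are not affected by the larger k. *)
Lemma Rmil_ins t v : v <= k ->
  (v \in Rmil p' t) = if v == k then (c == k) && (e == t) else v \in Rmil p t.
Proof.
move=> vk; apply: (picks_ins
  (P := fun i => [forall j : 'I_n.+1, (i < j) ==> (base p i < base p j)])) => //.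
  rewrite base_ins_c; apply/forallP/eqP => [h|ck' j].
    apply/val_inj/eqP; rewrite eqn_leq ck leqNgt; apply/negP => lt.
    have /= := h k; rewrite lt /= => kb.
    by have := stage_lt stage_p' (ltnSn k); rewrite ltnS leqNgt kb.
  apply/implyP => kj; have jk : k < j by rewrite -ck'.
  by have [-> _] := stage_p' jk.
move=> i ic pk; apply/forallP/forallP => h j; apply/implyP => ij.
  (* Each position of p is some [a z]; z = c gives the letter k, which is larger than the letter
     compared with it. *)
  have Ej : a (a^-1%g j) = j by rewrite permKV.
  move: ij; rewrite -Ej; move: (a^-1%g j) => z.
  case: (eqVneq z c) => [-> _|zc /(a_mono_inv ic zc) iz].
    by rewrite a_c (hp (leqnn k)).1.
  by have := h z; rewrite iz !bp'.
by have := h (a j); rewrite a_mono // !bp'.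
Qed.

(** Whatever precedes k is smaller, so k is a left-to-right minimum only if nothing precedes it. *)
Lemma Lmil_ins t v : v <= k ->
  (v \in Lmil p' t) = if v == k then (val c == 0) && (e == t) else v \in Lmil p t.
Proof.
move=> vk; apply: (picks_ins
  (P := fun i => [forall j : 'I_n.+1, (j < i) ==> (base p i < base p j)])) => //.
  rewrite base_ins_c; apply/forallP/eqP => [h|cz j]; last by rewrite cz.
  apply/eqP; rewrite -leqn0 leqNgt; apply/negP => lt.
  have /= := h ord0; rewrite lt /= => kb.
  by have := stage_lt stage_p' (ltn0Sn k : ord0 < k.+1); rewrite ltnS leqNgt kb.
move=> i ic pk; have aik : a i < k by rewrite -(stage_lt_iff _ hp).
apply/forallP/forallP => h j; apply/implyP => ij.
  have Ej : a (a^-1%g j) = j by rewrite permKV.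
  move: ij; rewrite -Ej; move: (a^-1%g j) => z.
  case: (eqVneq z c) => [->|zc /(a_mono_inv zc ic) iz].
    by rewrite a_c ltnNge ltnW.
  by have := h z; rewrite iz !bp'.
case: (eqVneq j c) => [->|jc]; first by rewrite base_ins_c bp'.
by have := h (a j); rewrite a_mono // !bp'.
Qed.

Lemma base_ins_lt i : i < c -> base p' i = base p i /\ col p' i = col p i.
Proof.
move=> ic; have inc : i != c by rewrite -(inj_eq val_inj) /= neq_ltn ic.
rewrite col_ins_neq // bp'; suff -> : a i = i by [].
apply: val_inj; rewrite /= av (negbTE inc); case: ifP => //; lia.
Qed.

End Ins.

(** The letter k at c exceeds all others at positions up to k, so it destroys the maxima between c
    and k; beyond k every fixed position is a maximum. Only the prefix before c is compared, so this
    serves insertion and sorting alike. *)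
Lemma lmax_step k c p p' i : c <= k -> (forall i, i < c -> base p' i = base p i) ->
  base p' c = k -> stage k.+1 p' ->
  lmax p' i = [|| (i < c) && lmax p i, i == c | k < i].
Proof.
move=> ck pp pc hp; have plt j : j != c -> j <= k -> base p' j < k.
  move=> jc jk; rewrite ltn_neqAle -ltnS (stage_lt hp) // andbT (inj_eq val_inj).
  by rewrite -pc base_eq.
have [ic|ci|/val_inj->] := ltngtP i c; last first.
- rewrite eqxx /=; apply/lmaxP => j jc; rewrite pc plt ?(leq_trans (ltnW jc)) //.
  by rewrite -(inj_eq val_inj) /= neq_ltn jc.
- rewrite -(inj_eq val_inj) /= (gtn_eqF ci) /=; apply/lmaxP/idP => [h|ki j ji].
    rewrite ltnNge; apply/negP => ik; have := h c ci; rewrite pc ltnNge ltnW // plt //.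
    by rewrite -(inj_eq val_inj) /= neq_ltn ci orbT.
  rewrite (hp i ki).1; case: (ltnP k j) => [kj|jk]; first by rewrite (hp j kj).1.
  by apply: leq_trans ki; apply: stage_lt hp _.
have -> : (i == c) = false by rewrite -(inj_eq val_inj) /= ltn_eqF.
have -> : (k < i) = false by lia.
rewrite /= orbF; apply/lmaxP/lmaxP => h j ji; have := h j ji;
  by rewrite !pp // (ltn_trans ji).
Qed.

(** * Cycles under a sorting step *)

Lemma porbit_sub (s : {perm 'I_n.+1}) i (A : {set 'I_n.+1}) : i \in A ->
  (forall j, j \in A -> s j \in A) -> porbit s i \subset A.
Proof.
move=> iA cl; apply/subsetP => j /porbitP[m ->]; rewrite permX.
by elim: m => [|m IH] //=; apply: cl.
Qed.

Lemma porbit_closed (s : {perm 'I_n.+1}) i j : j \in porbit s i -> s j \in porbit s i.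
Proof. by case/porbitP => m ->; rewrite -permM -expgSr mem_porbit. Qed.

Section Srt.
Variables (k c : 'I_n.+1) (e : 'I_r) (q : cp).
Hypotheses (ck : c <= k) (hq : stage k q).
Let q' := cmul q (srt k (c, e)).

Let bk : base q k = k. Proof. exact: (hq (leqnn k)).1. Qed.

Lemma base_srt_c : base q' c = k.
Proof. by rewrite cmul_base srt_base. Qed.

Lemma col_srt_c : col q' c = cneg e.
Proof.
rewrite col_cmul srt_base // col_srt eqxx (hq (leqnn k)).2.
by rewrite addn0 modn_small ?ltn_ord.
Qed.

Lemma base_srt_k : base q' k = base q c.
Proof. by rewrite cmul_base base_srt eqxx; case: eqP => // ->. Qed.

Lemma col_srt_k : c != k -> col q' k = (e + col q c) %% r.
Proof. by rewrite eq_sym => /negbTE h; rewrite col_cmul base_srt col_srt eqxx h. Qed.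

Lemma base_srt_neq i : i != c -> i != k -> base q' i = base q i.
Proof. by move=> /negbTE ic /negbTE ik; rewrite cmul_base base_srt ic ik. Qed.

Lemma col_srt_neq i : i != c -> i != k -> col q' i = col q i.
Proof.
move=> /negbTE ic /negbTE ik.
by rewrite col_cmul base_srt col_srt ic ik add0n modn_small ?col_lt.
Qed.

Lemma base_srt_lt i : i < c -> base q' i = base q i /\ col q' i = col q i.
Proof.
move=> ic; have inc : i != c by rewrite -(inj_eq val_inj) /= neq_ltn ic.
have ink : i != k by rewrite -(inj_eq val_inj) /= neq_ltn (leq_trans ic).
by rewrite base_srt_neq ?col_srt_neq.
Qed.

Let B v := porbit q.1 v.

Let k_notin v : v < k -> k \notin B v.
Proof.
move=> vk; apply/negP => kB.
have /subsetP/(_ _ kB) : B v \subset [set i : 'I_n.+1 | i < k].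
  by apply: porbit_sub => [|j]; rewrite !inE // => jk; apply: stage_lt hq _.
by rewrite inE ltnn.
Qed.

(** The arrow from c to q(c) becomes a path from c through k to q(c): k is spliced into the cycle of
    c. *)
Lemma porbit_srt v : v < k ->
  porbit q'.1 v = if c \in B v then k |: B v else B v.
Proof.
move=> vk; have kB := k_notin vk.
have cnk : c \in B v -> c != k by apply: contraTneq => ->.
have nk j : j \in B v -> j != k by apply: contraTneq => ->.
apply/eqP; rewrite eqEsubset; apply/andP; split.
  apply: porbit_sub => [|j].
    by case: ifP => _; rewrite ?inE porbit_id ?orbT.
  have cl i : i \in B v -> q.1 i \in B v by apply: porbit_closed.
  case: ifP => [cB|cB jB]; last first.
    have jc : j != c by apply: contraFneq cB => <-.
    by rewrite -[q'.1 j]/(base q' j) base_srt_neq ?nk // cl.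
  rewrite !inE -[q'.1 j]/(base q' j) => /orP[/eqP->|jB].
    by rewrite base_srt_k [base q c \in _]cl // orbT.
  case: (eqVneq j c) => [->|jc]; first by rewrite base_srt_c eqxx.
  by rewrite base_srt_neq ?nk // [base q j \in _]cl ?orbT.
have sub : B v \subset porbit q'.1 v.
  apply: porbit_sub => [|j jA]; first exact: porbit_id.
  have cl i : i \in porbit q'.1 v -> base q' i \in porbit q'.1 v by apply: porbit_closed.
  rewrite -[q.1 j]/(base q j); case: (eqVneq j k) jA => [->|jk] jA; first by rewrite bk.
  case: (eqVneq j c) jA => [->|jc] jA; last by rewrite -base_srt_neq ?cl.
  by have := cl _ (cl _ jA); rewrite base_srt_c base_srt_k.
case: ifP => // cB; rewrite subUset sub andbT sub1set.
have := porbit_closed (subsetP sub _ cB).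
by rewrite -[q'.1 c]/(base q' c) base_srt_c.
Qed.

(** For c < k the cycle of k contains c, so k is not its minimum. For v < k, splicing in the larger
    k keeps the minimum, and the colors -e at c and e at k cancel in the sum. *)
Lemma Cyc_srt t v : v <= k ->
  (v \in Cyc q' t) = if v == k then (c == k) && (cneg e == t) else v \in Cyc q t.
Proof.
rewrite leq_eqVlt => /orP[/eqP/val_inj->|vk]; rewrite !inE.
  rewrite eqxx; case: (eqVneq c k) => [Ec|cnk] /=; last first.
    apply/negbTE; rewrite negb_and; apply/orP; left.
    rewrite negb_forall; apply/existsP; exists c.
    rewrite negb_imply porbit_sym -{1}base_srt_c porbit_closed ?porbit_id //=.
    by rewrite -ltnNge ltn_neqAle ck andbT (inj_eq val_inj).
  have -> : porbit q'.1 k = [set k].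
    apply/eqP; rewrite eqEsubset sub1set porbit_id andbT.
    apply: porbit_sub => [|j]; rewrite !inE // => /eqP->.
    by rewrite -[q'.1 k]/(base q' k) -{1}Ec base_srt_c.
  have -> : \sum_(j in [set k]) col q' j = cneg e by rewrite big_set1 -{1}Ec col_srt_c.
  rewrite modn_small ?ltn_ord //.
  have -> // : [forall j in [set k], k <= j].
  by apply/forallP => j; rewrite inE; apply/implyP => /eqP->.
have vnk : v != k by rewrite -(inj_eq val_inj) /= neq_ltn vk.
rewrite (negbTE vnk); congr andb.
  apply/forallP/forallP => h j; have := h j; rewrite porbit_srt //;
    case: ifP => // _; rewrite !inE -/(B v).
    by case: (j \in B v); rewrite ?orbT.
  by case: (eqVneq j k) => [->|_] //= _; rewrite ltnW.
congr (_ == _); rewrite porbit_srt //; have kB := k_notin vk.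
have nk j : j \in B v -> j != k by apply: contraTneq => ->.
case: ifP => cB; last first.
  congr (_ %% _); apply: eq_bigr => j jB; rewrite col_srt_neq ?nk //.
  by apply: contraFneq cB => <-.
rewrite big_setU1 //= (bigD1 c) //= [in RHS](bigD1 c) //= col_srt_k ?nk // col_srt_c.
have -> : \sum_(j in B v | j != c) col q' j = \sum_(j in B v | j != c) col q j.
  by apply: eq_bigr => j /andP[jB jc]; rewrite col_srt_neq ?nk.
rewrite modnDml addnACA -modnDml cnegE add0n //.
Qed.

End Srt.

(** * First passages and cyclic left-to-right minima *)

Implicit Types (x y : 'I_n.+1 * nat).

(* v is in Lmic iff the trajectory of the letter 1 first reaches {0, ..., v} at v.
   This first passage does not see detours through larger letters such as k. *)
Inductive fpass q v : 'I_n.+1 * nat -> 'I_n.+1 * nat -> Prop :=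
| FpassStop x : x.1 <= v -> fpass q v x x
| FpassStep x y : v < x.1 -> fpass q v (cact q x) y -> fpass q v x y.

Lemma fpass_fun q v x y y' : fpass q v x y -> fpass q v x y' -> y = y'.
Proof.
move=> h; elim: h y' => {x y} [x xv|x y vx _ IH] y' h'.
  by case: x y' / h' xv => // x y vx _; rewrite leqNgt vx.
by case: x y' / h' vx IH => [x xv|x y' _ h' _]; [rewrite ltnNge xv | apply].
Qed.

Lemma fpassP q v x y : fpass q v x y <->
  exists m, [/\ iter m (cact q) x = y, y.1 <= v &
    forall l, l < m -> v < (iter l (cact q) x).1].
Proof.
split=> [|[m []]].
  elim=> {x y} [x xv|x y vx _ [m [E yv h]]]; first by exists 0.
  by exists m.+1; split=> [||[|l]] //; rewrite ?iterSr // ltnS => /h; rewrite -iterSr.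
elim: m x => [|m IH] x /= E yv h; first by rewrite -E; apply: FpassStop; rewrite /= E.
apply: FpassStep; first exact: (h 0).
by apply: IH => [|//|l lm]; rewrite -?iterSr //; apply: (h l.+1).
Qed.

Lemma iter_cact q m x : (iter m (cact q) x).1 = iter m q.1 x.1.
Proof. by elim: m => //= m ->. Qed.

Lemma return_ord0 q : exists2 m, m <= n & (iter m.+1 (cact q) (ord0, 0)).1 = ord0.
Proof.
have lt : #|porbit q.1 ord0| <= n.+1 by have := max_card (porbit q.1 ord0); rewrite card_ord.
have /prednK E : 0 < #|porbit q.1 ord0| by rewrite lt0n card_porbit_neq0.
exists #|porbit q.1 ord0|.-1; first by rewrite -ltnS E.
by rewrite iter_cact E iter_porbit.
Qed.

Lemma fpass_total q v : exists y, fpass q v (cact q (ord0, 0)) y.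
Proof.
have ex : exists m, (iter m.+1 (cact q) (ord0, 0)).1 <= v.
  by have [m _ E] := return_ord0 q; exists m; rewrite E.
case: (ex_minnP ex) => m hm mmin; exists (iter m.+1 (cact q) (ord0, 0)).
apply/fpassP; exists m; split=> [|//|l lm]; first by rewrite -iterSr.
by rewrite -iterSr ltnNge; apply/negP => /mmin; rewrite leqNgt lm.
Qed.

(** The trajectory meets base value 0 within n + 1 steps and no later than it closes up, so every
    first passage falls inside the search bounds of [Lmic]. *)
Lemma LmicP q t v : reflect (fpass q v (cact q (ord0, 0)) (v, val t)) (v \in Lmic q t).
Proof.
rewrite inE; apply: (iffP existsP) =>
  [[s /andP[/eqP s0 /existsP[k /and4P[k1 _ /eqP E /forallP h]]]]|].
  have {s0} Es : s = ord0 by apply: val_inj.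
  rewrite {s}Es in E h; apply/fpassP; case: k k1 E h => -[//|m] /= mlt _ E h.
  exists m; split=> [|//|l lm]; first by rewrite -iterSr.
  have llt : l.+1 < (n.+1 * r).+2 by apply: ltn_trans mlt.
  by have := h (Ordinal llt); rewrite /= !ltnS lm -iterSr.
case/fpassP => m [E _ h]; exists ord0; rewrite eqxx /=.
(* Base value 0 is at most v, so it cannot occur before the first passage. *)
have noz l : (iter l.+1 (cact q) (ord0, 0)).1 = ord0 -> m <= l.
  by move=> z; rewrite leqNgt; apply/negP => /h; rewrite -iterSr z.
have mn : m < n.+1 * r.
  have [l ln /noz ml] := return_ord0 q; have := r_gt0; nia.
have mlt : m.+1 < (n.+1 * r).+2 by lia.
apply/existsP; exists (Ordinal mlt).
rewrite -[nat_of_ord (Ordinal mlt)]/m.+1 [iter m.+1 _ _]iterSr E eqxx /=.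
apply/andP; split.
  set F := find _ _; rewrite ltnS; case: (ltnP F (n.+1 * r)) => [Flt|/(leq_trans (ltnW mn)) //].
  have := @nth_find _ 0 (fun l => iter l.+1 (cact q) (ord0, 0) == (ord0, 0)) (iota 0 (n.+1 * r)).
  rewrite has_find size_iota -/F => /(_ Flt); rewrite nth_iota // add0n => /eqP z.
  by apply: noz; rewrite z.
apply/forallP => -[[|l] llt] //=; apply/implyP; rewrite ltnS => /h.
by rewrite -iterSr.
Qed.

Section LmicSrt.
Variables (k c : 'I_n.+1) (e : 'I_r) (q : cp).
Hypotheses (ck : c <= k) (hq : stage k q).
Let q' := cmul q (srt k (c, e)).

Lemma cact_srt_neq x : x.1 != c -> x.1 != k -> cact q' x = cact q x.
Proof. by move=> xc xk; rewrite /cact base_srt_neq // col_srt_neq. Qed.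

Lemma cact_srt_c (z : nat) : (cact q' (c, z)).1 = k.
Proof. by rewrite /cact /= base_srt_c. Qed.

Lemma cact_srt_cc (z : nat) : c != k -> cact q' (cact q' (c, z)) = cact q (c, z).
Proof.
move=> cnk; rewrite /cact /= base_srt_c // base_srt_k // col_srt_k // col_srt_c //.
by rewrite modnDml modnDmr addnACA -modnDml cnegE add0n.
Qed.

(** After c, the trajectory of [q'] makes a detour through k > v, which does not stop the passage,
    and rejoins that of q with the same color since -e and e cancel. *)
Lemma fpass_srt v x y : v < k -> x.1 < k ->
  fpass q v x y -> fpass q' v x y.
Proof.
move=> vk xk h; elim: h xk => {x y} [x xv|x y vx _ IH] xk; first exact: FpassStop.
have ck' : (cact q x).1 < k by apply: stage_lt hq _.
have xnk : x.1 != k by rewrite -(inj_eq val_inj) /= neq_ltn xk.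
apply: FpassStep => //; case: (eqVneq x.1 c) => [xc|xc]; last first.
  by rewrite cact_srt_neq //; apply: IH.
move: xc xnk IH ck'; case: x {vx xk} => x z /= -> cnk IH ck'.
by apply: FpassStep; [rewrite cact_srt_c | rewrite cact_srt_cc //; apply: IH].
Qed.

Lemma Lmic_srt t v : v <= k ->
  (v \in Lmic q' t) = if v == k then (val c == 0) && (cneg e == t) else v \in Lmic q t.
Proof.
rewrite leq_eqVlt => /orP[/eqP/val_inj->|vk].
  rewrite eqxx.
  (* All letters met are at most k, so the passage to level k stops at the first one; that is k
     exactly when c = 0. *)
  have st : fpass q' k (cact q' (ord0, 0)) (cact q' (ord0, 0)).
    apply: FpassStop; rewrite -ltnS.
    exact: (@stage_lt k.+1 q' ord0 (stage_step srt_stage e ck hq) isT).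
  apply/LmicP/andP => [/(fpass_fun st)|[/eqP cz /eqP <-]].
    rewrite /cact /= => -[E1 E2].
    have c0 : ord0 = c by apply: (@base_inj q'); rewrite E1 base_srt_c.
    split; first by rewrite -c0.
    apply/eqP/val_inj; move: E2; rewrite c0 col_srt_c // addn0 modn_small //; exact: ltn_ord.
  have Ec : ord0 = c by apply: val_inj.
  suff Eq : cact q' (ord0, 0) = (k, val (cneg e)) by rewrite {2}Eq in st.
  by rewrite /cact /= Ec base_srt_c // col_srt_c // addn0 modn_small // (ltn_ord (cneg e)).
have vnk : v != k by rewrite -(inj_eq val_inj) /= neq_ltn vk.
rewrite (negbTE vnk).
have k0 : 0 < k by apply: leq_ltn_trans vk.
have [y hy] := fpass_total q v.
have hy' : fpass q' v (cact q' (ord0, 0)) y.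
  (* For c = 0 the trajectory of [q'] starts with k > v and rejoins that of q one step later. *)
  have [c0|c0] := eqVneq ord0 c.
    apply: FpassStep; first by rewrite c0 cact_srt_c.
    have cnk : c != k by rewrite -c0 -(inj_eq val_inj) /= neq_ltn k0.
    rewrite c0 (cact_srt_cc _ cnk) -c0.
    by apply: fpass_srt => //; apply: stage_lt hq _.
  rewrite cact_srt_neq //=; last by rewrite -(inj_eq val_inj) /= neq_ltn k0.
  by apply: fpass_srt => //; apply: stage_lt hq _.
by apply/LmicP/LmicP => h; [rewrite -(fpass_fun hy' h) | rewrite -(fpass_fun hy h)].
Qed.

End LmicSrt.

(** * Left-to-right maxima in the two encodings *)

Definition lmax_match p q := forall i, lmax p i = lmax q i /\
  (lmax p i -> base p i = base q i /\ q.2 i = cneg (p.2 i)).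

(** By [lmax_step] both factors change the set of maxima in the same way; the new one at c is the
    letter k, with color e or -e, and the others keep value and color. *)
Lemma lmax_build d m : valid d -> m <= n.+1 ->
  lmax_match (build ins d m) (build srt d m).
Proof.
move=> vd mn.
have [] // := @build_ind _ ins_stage
  (fun m p => m <= n.+1 -> lmax_match p (build srt d m)) d vd _ _ m mn.
- move=> _ i /=; split=> //; split=> //; apply: val_inj.
  by rewrite ffunE /= mod0n subn0 modnn.
- move=> k c e p ck dk hp IH km /=; rewrite inord_val dk.
  have hq := build_stage srt_stage vd (ltnW km).
  move: (build _ _ _) hq {IH}(IH (ltnW km)) => q hq IH i.
  have hp' := stage_step ins_stage e ck hp; have hq' := stage_step srt_stage e ck hq.
  have pb j (jc : j < c) := base_ins_lt e p ck jc.
  have qb j (jc : j < c) := base_srt_lt e q ck jc.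
  rewrite (lmax_step i ck (fun j jc => (pb j jc).1) (base_ins_c e ck hp) hp').
  rewrite (lmax_step i ck (fun j jc => (qb j jc).1) (base_srt_c e ck hq) hq').
  split; first by have [->] := IH i.
  case/or3P => [/andP[ic pm]|/eqP->|ki].
  - have [_ /(_ pm)[E1 E2]] := IH i; have [-> E3] := pb i ic; have [-> E4] := qb i ic.
    by split=> //; rewrite (val_inj E4 : _ = q.2 i) (val_inj E3 : _ = p.2 i).
  - rewrite base_ins_c ?base_srt_c //; split=> //; apply: val_inj.
    rewrite -[LHS]/(col _ _) col_srt_c //.
    congr (val (cneg _)); apply: val_inj; symmetry; exact: col_ins_c.
  have [-> E3] := hp' i ki; have [-> E4] := hq' i ki; split=> //.
  apply: val_inj; rewrite -[LHS]/(col _ _) E4 val_cneg -[val (_ i)]/(col _ _) E3.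
  by rewrite subn0 modnn.
by move=> /(_ mn).
Qed.

Lemma col_match p q i t : lmax_match p q -> lmax p i ->
  (col p i == t) = (col q i == cneg t).
Proof.
move=> h pm; have [_ /(_ pm)[_ E]] := h i.
by rewrite /col E !(inj_eq val_inj) (inj_eq (can_inj cnegK)).
Qed.

Lemma Lmap_match p q t : lmax_match p q -> Lmap p t = Lmap q (cneg t).
Proof.
move=> h; apply/setP => i; rewrite !inE -!/(lmax _ _) -(h i).1 andbC [RHS]andbC.
by case: (boolP (lmax p i)) => //= pm; apply: col_match.
Qed.

Lemma Lmal_match p q t : lmax_match p q -> Lmal p t = Lmal q (cneg t).
Proof.
move=> h; apply/setP => v; rewrite !inE; apply: eq_existsb => i.
rewrite -!/(lmax _ _) -(h i).1 andbC [RHS]andbC andbAC [RHS]andbAC.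
have [_] := h i; case: (boolP (lmax p i)) => [pm /(_ isT)[-> _]|_ _]; last by rewrite !andbF.
by rewrite (col_match t h pm).
Qed.

Lemma Gf_match f p q : (forall i j, i <= j -> f i <= f j) -> lmax_match p q ->
  (p \in @Gf r n.+1 f) = (q \in @Gf r n.+1 f).
Proof.
move=> fmono h; rewrite !mem_Gf //; apply: eq_forallb => i; rewrite -(h i).1.
by case: (boolP (lmax p i)) => // pm; have [_ /(_ pm)[-> _]] := h i.
Qed.

(** * The joint distribution *)

Lemma stat_build d : valid d -> stat1 (build ins d n.+1) = stat2 (build srt d n.+1).
Proof.
move=> vd; have h := lmax_build vd (leqnn _).
congr pair; first by rewrite ell_build // sor_build.
apply/ffunP => t; rewrite !ffunE (Lmap_match _ h) (Lmal_match _ h).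
(* What remains is [Rmil] against [Cyc], both decided by c = k, and [Lmil] against [Lmic], both
   decided by c = 0. *)
do 2!congr pair; congr pair; apply/setP => v.
  rewrite (mem_build ins_stage (b := fun c k => c == k) (g := id)) //; last first.
    by move=> k c e p ck hp s u uk; apply: Rmil_ins.
  rewrite (mem_build srt_stage (b := fun c k => c == k) (g := @cneg r)) //; last first.
    by move=> k c e p ck hp s u uk; apply: Cyc_srt.
  by rewrite (inj_eq (can_inj cnegK)).
rewrite (mem_build ins_stage (b := fun c _ => val c == 0) (g := id)) //; last first.
  by move=> k c e p ck hp s u uk; apply: Lmil_ins.
rewrite (mem_build srt_stage (b := fun c _ => val c == 0) (g := @cneg r)) //; last first.
  by move=> k c e p ck hp s u uk; apply: Lmic_srt.
by rewrite (inj_eq (can_inj cnegK)).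
Qed.

End Colored.

Theorem theoremA (r n : nat) (f : 'I_n -> nat) :
  1 <= r -> 1 <= n ->
  (forall i : 'I_n, 1 <= f i <= n) ->
  (forall i j : 'I_n, i <= j -> f i <= f j) ->
  forall v : statT r n,
    #|[set p in @Gf r n f | @stat1 r n p == v]| = #|[set p in @Gf r n f | @stat2 r n p == v]|.
Proof.
case: n f => [//|n] f r1 _ _ fmono v; pose r0 := Ordinal r1.
(* Both counts become counts of valid codes; a single code then yields equal statistics and, through
   its maxima, equal membership in the shape. *)
rewrite (card_build r0 (@ins_stage _ _ r0) (@ins_base _ _ r0) (@ins_col _ _ r0)).
rewrite (card_build r0 (@srt_stage _ _ r0) (@srt_base _ _ r0) (@srt_col _ _ r0)).
apply: eq_card => d; rewrite !inE; case: (boolP (valid d)) => //= vd.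
by have := Gf_match fmono (lmax_build r0 vd (leqnn _)); rewrite stat_build // !inE => ->.
Qed.
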